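(* Let $0<p\le 1$ and let $f:[0,\infty)\to\mathbb{R}$ be a continuous function such that $$f(A\sharp B)\le f\left(A^{1/2} f_{\mu,p}\left(A^{-1/2}BA^{-1/2}\right)A^{1/2}\right)$$ for all positive integers $n$ and all positive definite $n\times n$ complex matrices $A$ and $B$. Then $f$ is operator monotone on $(0,\infty)$.
   Context: For Hermitian matrices, $X\le Y$ means that $Y-X$ is positive semidefinite (Loewner order), and $f(X)$ is defined by the functional calculus. For positive definite $A,B$ of the same size, the geometric mean is $A\sharp B=A^{1/2}(A^{-1/2}BA^{-1/2})^{1/2}A^{1/2}$. For $t>0$, $f_{\mu,p}(t)=\left(\frac{1+t^p}{2}\right)^{1/p}$. A continuous real function $f$ is operator monotone on an interval $I\subset\mathbb{R}$ if, for every $n$ and all Hermitian $n\times n$ complex matrices $A,B$ with spectra in $I$, $A\le B$ implies $f(A)\le f(B)$. *)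

(* Defs.v *)
From mathcomp Require Import all_boot all_order all_algebra.
From mathcomp Require Import complex.
From mathcomp Require Import classical_sets set_interval reals topology.
From mathcomp Require Import normedtype exp.

Set Implicit Arguments.
Unset Strict Implicit.
Unset Printing Implicit Defensive.

Import Order.TTheory GRing.Theory Num.Theory.
Import numFieldNormedType.Exports.

Local Open Scope classical_set_scope.
Local Open Scope ring_scope.
Local Open Scope complex_scope.
Local Open Scope sesquilinear_scope.

Definition psdmx (R : realType) (n : nat) (A : 'M[R[i]]_n) : Prop :=
  A \is hermsymmx /\
  forall v : 'cV[R[i]]_n, 0 <= (v ^t* *m A *m v) ord0 ord0.

Definition pdmx (R : realType) (n : nat) (A : 'M[R[i]]_n) : Prop :=
  A \is hermsymmx /\
  forall v : 'cV[R[i]]_n, v != 0 -> 0 < (v ^t* *m A *m v) ord0 ord0.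

Definition loewner_le (R : realType) (n : nat) (X Y : 'M[R[i]]_n) : Prop :=
  psdmx (Y - X).

(* Functional calculus; meaningful for Hermitian [A], where
   [A = invmx (spectralmx A) *m diag_mx (spectral_diag A) *m spectralmx A] with
   [spectralmx A] unitary and [spectral_diag A] real, so that taking real parts
   of the diagonal loses nothing. *)
Definition mxfun (R : realType) (n : nat) (f : R -> R) (A : 'M[R[i]]_n) :
    'M[R[i]]_n :=
  invmx (spectralmx A)
    *m diag_mx (map_mx (fun z => (f (complex.Re z))%:C) (spectral_diag A))
    *m spectralmx A.

(* [powR] is the usual real power on positive arguments, hence [mxpow A r] is
   the usual [A ^ r] for positive definite [A]. *)
Definition mxpow (R : realType) (n : nat) (A : 'M[R[i]]_n) (r : R) :
    'M[R[i]]_n :=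
  mxfun (fun t => powR t r) A.

(* [mxmean g A B] is [A^(1/2) g(A^(-1/2) B A^(-1/2)) A^(1/2)]. *)
Definition mxmean (R : realType) (n : nat) (g : R -> R) (A B : 'M[R[i]]_n) :
    'M[R[i]]_n :=
  mxpow A 2^-1
    *m mxfun g (mxpow A (- 2^-1) *m B *m mxpow A (- 2^-1))
    *m mxpow A 2^-1.

Definition geomean (R : realType) (n : nat) (A B : 'M[R[i]]_n) : 'M[R[i]]_n :=
  mxmean (fun t => powR t 2^-1) A B.

Definition fmu (R : realType) (p t : R) : R :=
  powR ((1 + powR t p) / 2) p^-1.

Definition spectrum_in (R : realType) (n : nat) (I : interval R)
    (A : 'M[R[i]]_n) : Prop :=
  forall z : R[i], eigenvalue A z -> exists2 t : R, t \in I & z = t%:C.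

(* Only the values of [f] on [I] matter. *)
Definition operator_monotone (R : realType) (I : interval R) (f : R -> R) :
    Prop :=
  {within [set` I], continuous f} /\
  forall (n : nat) (A B : 'M[R[i]]_n), (0 < n)%N ->
    A \is hermsymmx -> B \is hermsymmx ->
    spectrum_in I A -> spectrum_in I B ->
    loewner_le A B -> loewner_le (mxfun f A) (mxfun f B).

(* Main.v *)
(* Any positive definite [X <= Y] are the two means of a single pair [A, B],
   so the hypothesis at [A, B] reads [f(X) <= f(Y)].  Set
   [T := X^(-1/2) Y X^(-1/2) >= 1] and solve [(C^p + C^(-p)) / 2 = T^p] for [C]
   by functional calculus in [T].  Since [C] and [C^-1] commute, their geometric
   mean is [1] and their power mean is [T]; as means are invariant under
   congruence, [A := X^(1/2) C X^(1/2)] and [B := X^(1/2) C^-1 X^(1/2)] have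
   means [X] and [Y]. *)

Require Import Defs.
From mathcomp Require Import all_boot all_order all_algebra.
From mathcomp Require Import complex.
From mathcomp Require Import classical_sets set_interval reals topology.
From mathcomp Require Import normedtype exp.
From mathcomp Require Import ring.

Import Order.TTheory GRing.Theory Num.Theory.
Import numFieldNormedType.Exports.

Local Open Scope classical_set_scope.
Local Open Scope ring_scope.
Local Open Scope complex_scope.

(** * Adjoints and Hermitian matrices *)

Section Adjoint.
Local Open Scope sesquilinear_scope.
Context {C : numClosedFieldType}.

Lemma trmxC_mul m n k (A : 'M[C]_(m, n)) (B : 'M[C]_(n, k)) :
  (A *m B)^t* = B^t* *m A^t*.
Proof. by rewrite trmx_mul map_mxM. Qed.

Lemma hermsymmxP n (A : 'M[C]_n) : reflect (A^t* = A) (A \is hermsymmx).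
Proof.
apply: (iffP (is_hermitianmxP _ _ _)); rewrite expr0 scale1r.
  by move=> {2}->.
by move=> ->.
Qed.

End Adjoint.

(** * Functional calculus by unitary diagonalization *)

Section FunctionalCalculus.
Local Open Scope sesquilinear_scope.
Context {R : realType} {n : nat}.
Implicit Types (A D P S : 'M[R[i]]_n) (f g : R -> R).

Definition real_diag (d : 'I_n -> R) : 'M[R[i]]_n :=
  diag_mx (\row_i (d i)%:C).

Definition spectral_val A (i : 'I_n) : R :=
  complex.Re (spectral_diag A ord0 i).

Lemma eq_real_diag d d' : d =1 d' -> real_diag d = real_diag d'.
Proof. by move=> e; congr diag_mx; apply/rowP => i; rewrite !mxE e. Qed.

Lemma real_diagM d d' :
  real_diag d *m real_diag d' = real_diag (fun i => d i * d' i).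
Proof.
rewrite /real_diag mulmx_diag; congr diag_mx.
by apply/rowP => i; rewrite !mxE rmorphM.
Qed.

Lemma real_diag_adj d : (real_diag d)^t* = real_diag d.
Proof.
rewrite /real_diag tr_diag_mx map_diag_mx; congr diag_mx.
by apply/rowP => i; rewrite !mxE; apply: conjc_real.
Qed.

Lemma mxfunE f A : mxfun f A =
  (spectralmx A)^t* *m real_diag (f \o spectral_val A) *m spectralmx A.
Proof.
rewrite /mxfun (invmx_unitary (spectral_unitarymx A)) /real_diag.
suff -> : map_mx (fun z => (f (complex.Re z))%:C) (spectral_diag A) =
    \row_i ((f \o spectral_val A) i)%:C by [].
by apply/rowP => i; rewrite !mxE.
Qed.

(** The spectral theorem in the form used below: reading [A] as [mxfun id A] exposes its
    diagonalization. Real parts lose nothing because the spectrum is real. *)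
Lemma mxfun_id A : A \is hermsymmx -> mxfun id A = A.
Proof.
move=> hA; have /hermitian_normalmx/orthomx_spectralP {2}-> := hA.
suff e : map_mx (fun z => (complex.Re z)%:C) (spectral_diag A) = spectral_diag A.
  by rewrite /mxfun e.
apply/rowP => i; rewrite mxE.
by have /mxOverP/(_ ord0 i)/RRe_real := hermitian_spectral_diag_real hA.
Qed.

Local Opaque mxfun spectralmx.

(** The functional calculus does not depend on the diagonalization: the chosen [spectralmx] may
    differ from [P], but the transition matrix only links equal diagonal values. *)
Lemma mxfun_unitary f P d : P \is unitarymx ->
  mxfun f (P^t* *m real_diag d *m P) = P^t* *m real_diag (f \o d) *m P.
Proof.
move=> Pu; set A := P^t* *m _ *m P.
have PPt : P *m P^t* = 1%:M by apply/unitarymxP.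
have PtP : P^t* *m P = 1%:M by apply: mulmx1C.
have Ah : A \is hermsymmx.
  by apply/hermsymmxP; rewrite /A !trmxC_mul trmxCK real_diag_adj mulmxA.
set U := spectralmx A; set e := spectral_val A.
have UUt : U *m U^t* = 1%:M by apply/unitarymxP/spectral_unitarymx.
have UtU : U^t* *m U = 1%:M by apply: mulmx1C.
(* Both diagonalizations give the same [A], so [W = P U^*] intertwines [d] and [e]. *)
have twine : real_diag d *m (P *m U^t*) = (P *m U^t*) *m real_diag e.
  have : A = U^t* *m real_diag e *m U.
    by rewrite -{1}(mxfun_id _ Ah) mxfunE.
  move=> /(congr1 (fun M => P *m M *m U^t*)).
  by rewrite /A !mulmxA PPt mul1mx -!mulmxA UUt mulmx1.
(* Entrywise, [d i * W i j = W i j * e j]: either [W i j = 0] or [d i = e j], and both cases survive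
   applying [f]. *)
have twinef : real_diag (f \o d) *m (P *m U^t*) =
    (P *m U^t*) *m real_diag (f \o e).
  move: (P *m U^t* ) twine => W /matrixP twine; apply/matrixP => i j.
  move: (twine i j); rewrite /real_diag !mul_diag_mx !mul_mx_diag !mxE /=.
  have [->|w0] := eqVneq (W i j) 0; first by rewrite !(mul0r, mulr0).
  by rewrite [RHS]mulrC => /(mulIf w0)/complexI ->; rewrite mulrC.
rewrite mxfunE -/U -/e.
transitivity (P^t* *m ((P *m U^t*) *m real_diag (f \o e)) *m U).
  by rewrite !mulmxA PtP mul1mx.
by rewrite -twinef -(mulmxA (P^t* )) -!(mulmxA (real_diag _)) -(mulmxA P) UtU mulmx1 mulmxA.
Qed.

Lemma mxfun_adj f A : (mxfun f A)^t* = mxfun f A.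
Proof. by rewrite mxfunE !trmxC_mul trmxCK real_diag_adj mulmxA. Qed.

Lemma mxfun_herm f A : mxfun f A \is hermsymmx.
Proof. exact/hermsymmxP/mxfun_adj. Qed.

Lemma mxfunM f g A : mxfun f A *m mxfun g A = mxfun (fun t => f t * g t) A.
Proof.
rewrite !mxfunE -!mulmxA (mulmxA (spectralmx A)).
have /unitarymxP -> := spectral_unitarymx A.
by rewrite mul1mx (mulmxA (real_diag _)) real_diagM.
Qed.

Lemma eq_mxfun f g A :
  (forall i, f (spectral_val A i) = g (spectral_val A i)) ->
  mxfun f A = mxfun g A.
Proof.
move=> fg; rewrite !mxfunE.
by rewrite (eq_real_diag (f \o spectral_val A) (g \o spectral_val A)).
Qed.

Lemma mxfun_cst1 A : mxfun (fun=> 1) A = 1%:M.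
Proof.
have /unitarymxP/mulmx1C UtU := spectral_unitarymx A.
rewrite mxfunE -UtU; congr (_ *m _); rewrite -[RHS]mulmx1; congr (_ *m _).
by apply/matrixP => i j; rewrite !mxE.
Qed.

(** [mxfun g A] is diagonalized by [spectralmx A], possibly not by the unitary chosen for it;
    [mxfun_unitary] absorbs the difference. *)
Lemma mxfun_comp f g A : mxfun f (mxfun g A) = mxfun (f \o g) A.
Proof. by rewrite [mxfun g A]mxfunE (mxfun_unitary _ _ _ (spectral_unitarymx A)) mxfunE. Qed.

(** [spectralmx A *m P] is a unitary diagonalizing the conjugated matrix, with the same diagonal. *)
Lemma mxfun_conj f A P : A \is hermsymmx -> P \is unitarymx ->
  mxfun f (P^t* *m A *m P) = P^t* *m mxfun f A *m P.
Proof.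
move=> Ah Pu; rewrite -{1}(mxfun_id _ Ah) [mxfun id A]mxfunE [mxfun f A]mxfunE.
have Uu : spectralmx A *m P \is unitarymx.
  exact: mul_unitarymx (spectral_unitarymx A) Pu.
have := mxfun_unitary f _ (id \o spectral_val A) Uu; rewrite trmxC_mul.
move: (spectralmx A) (real_diag _) (real_diag _) => U D D'.
by rewrite !mulmxA.
Qed.

(** * Spectral values, eigenvalues and quadratic forms *)

Lemma eigenvalue_spectral_val A i :
  A \is hermsymmx -> eigenvalue A (spectral_val A i)%:C.
Proof.
move=> Ah; apply/eigenvalueP; exists (row i (spectralmx A)).
  have /unitarymxP UUt := spectral_unitarymx A.
  rewrite -row_mul -{2}(mxfun_id _ Ah) mxfunE !mulmxA UUt mul1mx.
  by apply/rowP => j; rewrite /real_diag mul_diag_mx !mxE.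
apply/eqP => /(congr1 (mulmx^~ (invmx (spectralmx A)))).
rewrite mul0mx -row_mul mulmxV ?spectral_unit// => /rowP/(_ i).
by rewrite !mxE eqxx => /eqP; rewrite oner_eq0.
Qed.

(** Evaluating the quadratic form at a unit eigenvector, the adjoint of a row of [spectralmx A],
    turns order conditions on [A] into bounds on its spectral values. *)
Lemma spectral_val_form A i : A \is hermsymmx ->
  exists2 v : 'cV[R[i]]_n, v^t* *m v = 1%:M &
    v^t* *m A *m v = (spectral_val A i)%:C%:M.
Proof.
move=> Ah; have /unitarymxP UUt := spectral_unitarymx A.
have entry (M : 'M[R[i]]_n) :
    delta_mx ord0 i *m M *m (delta_mx ord0 i : 'rV[R[i]]_n)^t* = (M i i)%:M.
  rewrite trmx_delta map_delta_mx -rowE -colE.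
  by apply/matrixP => j k; rewrite !ord1 !mxE.
exists ((row i (spectralmx A))^t*); rewrite trmxCK !rowE trmxC_mul.
  by rewrite mulmxA -(mulmxA _ (spectralmx A)) UUt entry mxE eqxx.
rewrite -[X in _ *m X *m _](mxfun_id _ Ah) mxfunE !mulmxA.
rewrite -(mulmxA _ (spectralmx A)) UUt mulmx1.
rewrite -(mulmxA _ (spectralmx A)) UUt mulmx1.
by rewrite entry !mxE eqxx.
Qed.

Lemma pdmx_spectral_val_gt0 A i : pdmx A -> 0 < spectral_val A i.
Proof.
move=> [Ah Ap]; have [v v1 Av] := spectral_val_form _ i Ah.
have /Ap : v != 0.
  apply/eqP => v0; move/matrixP/(_ ord0 ord0)/eqP: v1.
  by rewrite v0 mulmx0 !mxE eq_sym oner_eq0.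
by rewrite Av mxE eqxx mulr1n ltcR.
Qed.

Lemma psdmx_spectral_val_ge1 A i : psdmx (A - 1%:M) ->
  A \is hermsymmx -> 1 <= spectral_val A i.
Proof.
move=> [_ Ap] Ah; have [v v1 Av] := spectral_val_form _ i Ah.
have := Ap v; rewrite mulmxBr mulmx1 mulmxBl Av v1 !mxE eqxx mulr1n.
by rewrite -[1]/(1%:C) -rmorphB /= lecR subr_ge0.
Qed.

Lemma spectrum_in_spectral_val A i : A \is hermsymmx ->
  spectrum_in `]0, +oo[ A -> 0 < spectral_val A i.
Proof.
move=> Ah /(_ _ (eigenvalue_spectral_val _ i Ah))[t + /complexI ->].
by rewrite in_itv /= andbT.
Qed.

Lemma psdmx_conj A P : psdmx A -> psdmx (P^t* *m A *m P).
Proof.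
move=> [/hermsymmxP Ah Ap]; split.
  by apply/hermsymmxP; rewrite !trmxC_mul trmxCK Ah mulmxA.
by move=> v; have := Ap (P *m v); rewrite trmxC_mul !mulmxA.
Qed.

(** The form at [v] is the squared norm of [P *m v], and an invertible [P] kills no nonzero
    vector. *)
Lemma pdmx_gram P : P \in unitmx -> pdmx (P^t* *m P).
Proof.
move=> Pu; split; first by apply/hermsymmxP; rewrite trmxC_mul trmxCK.
move=> v v0; rewrite mulmxA -trmxC_mul -mulmxA.
have : P *m v != 0.
  by apply: contra_neq v0 => /(congr1 (mulmx (invmx P))); rewrite mulKmx// mulmx0.
move: (P *m v) => w w0; rewrite mxE lt0r; apply/andP; split; last first.
  by apply: sumr_ge0 => j _; rewrite !mxE mulrC mul_conjC_ge0.
apply: contra w0 => /eqP/psumr_eq0P w0; apply/eqP/colP => j.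
have /w0/(_ j isT)/eqP : forall k, xpredT k -> 0 <= (w^t* ) ord0 k * w k ord0.
  by move=> k _; rewrite !mxE mulrC mul_conjC_ge0.
by rewrite !mxE mulrC mul_conjC_eq0 => /eqP.
Qed.

(** * Matrix powers and congruence of means *)

Lemma mxpowD A (r s : R) : (forall i, 0 < spectral_val A i) ->
  mxpow A r *m mxpow A s = mxpow A (r + s).
Proof.
move=> A0; rewrite /mxpow mxfunM; apply: eq_mxfun => i.
(* Exponents fail to add at a zero base, where [powR 0 r] is [0] for nonzero [r] but [1] for
   [r = 0]. *)
by rewrite powRD// lt0r_neq0 ?implybT.
Qed.

Lemma mxpow0 A : mxpow A 0 = 1%:M.
Proof. by rewrite -(mxfun_cst1 A); apply: eq_mxfun => i; rewrite powRr0. Qed.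

Lemma mxpow1 A : A \is hermsymmx -> (forall i, 0 < spectral_val A i) ->
  mxpow A 1 = A.
Proof.
move=> Ah A0; rewrite -[RHS](mxfun_id _ Ah); apply: eq_mxfun => i.
by rewrite powRr1// ltW.
Qed.

Lemma mxpow_half A : A \is hermsymmx -> (forall i, 0 < spectral_val A i) ->
  mxpow A 2^-1 *m mxpow A 2^-1 = A.
Proof. by move=> Ah A0; rewrite mxpowD// -div1r -splitr mxpow1. Qed.

Lemma mxpow_halfV A : (forall i, 0 < spectral_val A i) ->
  mxpow A 2^-1 *m mxpow A (- 2^-1) = 1%:M.
Proof. by move=> A0; rewrite mxpowD// subrr mxpow0. Qed.

(* With [A := S^* S], the factor [S A^(-1/2)] of the polar decomposition of [S]
   is unitary, so the functional calculus commutes with conjugation by it. *)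
Lemma mxmean_congr g S D : S \in unitmx -> D \is hermsymmx ->
  mxmean g (S^t* *m S) (S^t* *m D *m S) = S^t* *m mxfun g D *m S.
Proof.
move=> Su Dh; rewrite /mxmean; set A := S^t* *m S.
have Apd : pdmx A by exact: pdmx_gram.
have A0 i : 0 < spectral_val A i by exact: pdmx_spectral_val_gt0.
have Ah : A \is hermsymmx by case: Apd.
have GGi := mxpow_halfV _ A0; have GiG := mulmx1C GGi.
have GG := mxpow_half _ Ah A0.
have GiT : (mxpow A (- 2^-1))^t* = mxpow A (- 2^-1) by exact: mxfun_adj.
move: (mxpow A 2^-1) (mxpow A (- 2^-1)) => G Gi in GGi GiG GG GiT *.
have VV : (S *m Gi)^t* *m (S *m Gi) = 1%:M.
  rewrite trmxC_mul GiT mulmxA -(mulmxA Gi) -/A -GG mulmxA GiG mul1mx.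
  by rewrite GGi.
have Vu : S *m Gi \is unitarymx by apply/unitarymxP/mulmx1C.
have -> : Gi *m (S^t* *m D *m S) *m Gi = (S *m Gi)^t* *m D *m (S *m Gi).
  by rewrite trmxC_mul GiT !mulmxA.
rewrite (mxfun_conj _ _ _ Dh Vu) trmxC_mul GiT !mulmxA GGi mul1mx -!mulmxA GiG.
by rewrite mulmx1.
Qed.

(** For [P = k(A) S] the two arguments are [P^* P] and [P^* j(A) P], so [mxmean_congr] applies and
    reduces the mean to the scalar expression [k g(j) k]. *)
Lemma mxmean_mxfun g (k j : R -> R) A S : A \is hermsymmx -> S \in unitmx ->
  mxfun k A \in unitmx ->
  mxmean g (S^t* *m mxfun (fun t => k t * k t) A *m S)
    (S^t* *m mxfun (fun t => k t * j t * k t) A *m S) =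
  S^t* *m mxfun (fun t => k t * g (j t) * k t) A *m S.
Proof.
move=> Ah Su Ku; pose P := mxfun k A *m S.
have Pt : P^t* = S^t* *m mxfun k A by rewrite trmxC_mul mxfun_adj.
have conjP h : P^t* *m mxfun h A *m P =
    S^t* *m mxfun (fun t => k t * h t * k t) A *m S.
  rewrite Pt /P -(mxfunM (fun t => k t * h t)) -mxfunM.
  by move: (mxfun k A) (mxfun h A) => K M; rewrite !mulmxA.
rewrite -[X in mxmean g _ X](conjP j) -[RHS](conjP (g \o j)) -(mxfun_comp g).
have PtP : S^t* *m mxfun (fun t => k t * k t) A *m S = P^t* *m P.
  by rewrite Pt /P -mxfunM; move: (mxfun k A) => K; rewrite !mulmxA.
rewrite [X in mxmean g X _]PtP; apply: mxmean_congr; last exact: mxfun_herm.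
by rewrite /P unitmx_mul Ku Su.
Qed.

End FunctionalCalculus.

(** * The scalar equation for the power mean *)

Section ScalarSolution.
Context {R : realType}.
Implicit Types p t : R.

(* With [u := t^p + sqrt (t^2p - 1)] one has [(u + u^-1) / 2 = t^p], so
   [c := u^(1/p)] solves [(c^p + c^-p) / 2 = t^p]; this is the square root
   of [c]. *)
Definition mean_root p t : R :=
  powR (powR t p + Num.sqrt (powR t p ^+ 2 - 1)) (p^-1 / 2).

Lemma mean_root_gt0 p t : 1 <= t -> 0 < mean_root p t.
Proof.
move=> t1; apply: powR_gt0; rewrite ltr_pwDl ?sqrtr_ge0// powR_gt0//.
exact: lt_le_trans t1.
Qed.

(** With [c = k^2], hence [c^p = u], moving [c] inside the [1/p]-th power turns [c * fmu p (c^-2)]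
    into [((u + u^-1) / 2)^(1/p)]. *)
Lemma fmu_mean_root p t (k := mean_root p t) : 0 < p -> 1 <= t ->
  k * fmu p ((k * k)^-1 * (k * k)^-1) * k = t.
Proof.
move=> p0 t1; have t0 : 0 < t by exact: lt_le_trans t1.
have pN0 : p != 0 by exact: lt0r_neq0.
rewrite /k /mean_root; set s := powR t p; set r := Num.sqrt _; set u := s + r.
have s1 : 1 <= s.
  have := ge0_ler_powR (ltW p0) _ _ t1.
  by rewrite powR1 !nnegrE ler01 ltW//; apply.
have r2 : r ^+ 2 = s ^+ 2 - 1 by rewrite sqr_sqrtr// subr_ge0 exprn_ege1.
have u0 : 0 < u by rewrite ltr_pwDl ?sqrtr_ge0// (lt_le_trans ltr01).
rewrite -mulrA mulrC -mulrA -powRD ?lt0r_neq0 ?implybT// -splitr.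
have wp : powR (powR u p^-1)^-1 p = u^-1.
  by rewrite -powRN -powRrM mulNr mulVf// powR_inv1// ltW.
rewrite /fmu [X in 1 + X]powRM ?invr_ge0 ?powR_ge0// wp mulrC -powRM ?ltW//; last first.
  by rewrite divr_gt0// addr_gt0// mulr_gt0// invr_gt0.
have -> : u * ((1 + u^-1 * u^-1) / 2) = s.
  (* [(s + r)(s - r) = s^2 - r^2 = 1], so [u^-1 = s - r] and the square roots cancel in
     [u + u^-1]. *)
  have ur : u * (s - r) = 1 by rewrite /u mulrC -subr_sqr r2 opprB addrC subrK.
  have -> : u * ((1 + u^-1 * u^-1) / 2) = (u + u^-1) / 2.
    by rewrite mulrA mulrDr mulr1 mulrA mulfV ?lt0r_neq0// mul1r.
  have -> : u^-1 = s - r.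
    by apply: (mulfI (lt0r_neq0 u0)); rewrite mulfV ?lt0r_neq0.
  by rewrite /u addrACA subrr addr0 mulrDl -splitr.
by rewrite /s -powRrM mulfV// powRr1// ltW.
Qed.

Lemma sqrt_mean_root (k : R) : 0 < k ->
  k * powR ((k * k)^-1 * (k * k)^-1) 2^-1 * k = 1.
Proof.
move=> k0; have kk0 : 0 < (k * k)^-1 by rewrite invr_gt0 mulr_gt0.
rewrite powR12_sqrt ?mulr_ge0 ?ltW// -expr2 sqrtr_sqr gtr0_norm//.
by field; rewrite lt0r_neq0.
Qed.

End ScalarSolution.

(** * Ordered matrices as means of one pair *)

Section MeanDecomposition.
Local Open Scope sesquilinear_scope.

Lemma mean_decomposition (R : realType) (n : nat) (p : R) (X Y : 'M[R[i]]_n) :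
  0 < p -> X \is hermsymmx -> (forall i, 0 < spectral_val X i) ->
  Y \is hermsymmx -> loewner_le X Y ->
  exists A B : 'M[R[i]]_n,
    [/\ pdmx A, pdmx B, geomean A B = X & mxmean (fmu p) A B = Y].
Proof.
move=> p0 Xh X0 Yh XY.
have HH := mxpow_half _ Xh X0; have HHi := mxpow_halfV _ X0.
have HiH := mulmx1C HHi.
have HT : (mxpow X 2^-1)^t* = mxpow X 2^-1 by exact: mxfun_adj.
have HiT : (mxpow X (- 2^-1))^t* = mxpow X (- 2^-1) by exact: mxfun_adj.
move: (mxpow X 2^-1) (mxpow X (- 2^-1)) => H Hi in HH HHi HiH HT HiT *.
have Hu : H \in unitmx by case: (mulmx1_unit HHi).
pose T := Hi *m Y *m Hi.
have Th : T \is hermsymmx.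
  apply/hermsymmxP; move/hermsymmxP: Yh => Yh.
  by rewrite /T !trmxC_mul HiT Yh mulmxA.
(* Congruence by [X^(-1/2)] turns [X <= Y] into [1 <= T], which keeps the radicand in [mean_root]
   nonnegative on the spectrum of [T]. *)
have T1 i : 1 <= spectral_val T i.
  apply: (psdmx_spectral_val_ge1 _ _ _ Th); have := psdmx_conj _ Hi XY.
  by rewrite HiT mulmxBr mulmxBl -HH !mulmxA HiH mul1mx HHi.
have HTH : H *m T *m H = Y.
  by rewrite /T !mulmxA HHi mul1mx -mulmxA HiH mulmx1.
(* Here [C = k(T)^2], and [j = k^-4] gives [k j k = k^-2], so that [C^-1] has the shape required by
   [mxmean_mxfun]. *)
pose k := mean_root p; pose j t := (k t * k t)^-1 * (k t * k t)^-1.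
have k0 i : 0 < k (spectral_val T i) by exact: mean_root_gt0.
have mxfunK h h' : (forall t, 0 < k t -> h t * h' t = 1) ->
    mxfun h T *m mxfun h' T = 1%:M.
  by move=> hh'; rewrite mxfunM -(mxfun_cst1 T); apply: eq_mxfun => i; exact: hh'.
have unitK h : (forall t, 0 < k t -> h t != 0) -> mxfun h T \in unitmx.
  move=> h0; have hV : mxfun h T *m mxfun (fun t => (h t)^-1) T = 1%:M.
    by apply: mxfunK => t /h0/mulfV.
  exact: (mulmx1_unit hV).1.
have Ku : mxfun k T \in unitmx by apply: unitK => t /lt0r_neq0.
have pdH h : (forall t, 0 < k t -> h t != 0) ->
    pdmx (H *m mxfun (fun t => h t * h t) T *m H).
  move=> /unitK hu.
  (* A Gram matrix of the invertible [h(T) H]; [h = k] yields [A] and [h = k^-1] yields [B]. *)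
  have -> : H *m mxfun (fun t => h t * h t) T *m H =
      (mxfun h T *m H)^t* *m (mxfun h T *m H).
    rewrite trmxC_mul mxfun_adj HT -mxfunM.
    by move: (mxfun h T) => K; rewrite !mulmxA.
  by apply: pdmx_gram; rewrite unitmx_mul hu.
have mean g : mxmean g (H *m mxfun (fun t => k t * k t) T *m H)
    (H *m mxfun (fun t => k t * j t * k t) T *m H) =
    H *m mxfun (fun t => k t * g (j t) * k t) T *m H.
  by have := mxmean_mxfun g k j _ _ Th Hu Ku; rewrite HT.
exists (H *m mxfun (fun t => k t * k t) T *m H).
exists (H *m mxfun (fun t => k t * j t * k t) T *m H); split.
- by apply: pdH => t /lt0r_neq0.
- rewrite (eq_mxfun _ (fun t => (k t)^-1 * (k t)^-1)).
    by apply: pdH => t kt; rewrite invr_eq0 lt0r_neq0.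
  move=> i; have := lt0r_neq0 (k0 i); rewrite /j.
  by move: (k _) => u u0; field.
- rewrite /geomean mean (eq_mxfun _ (fun=> 1)) => [|i]; last exact: sqrt_mean_root.
  by rewrite mxfun_cst1 mulmx1.
- rewrite mean (eq_mxfun _ id) => [|i]; last exact: fmu_mean_root.
  by rewrite (mxfun_id _ Th).
Qed.

End MeanDecomposition.

Theorem theorem2 (R : realType) (p : R) (f : R -> R)
  (hp0 : 0 < p) (hp1 : p <= 1)
  (hfc : {within [set` `[0, +oo[], continuous f})
  (hf : forall (n : nat) (A B : 'M[R[i]]_n), (0 < n)%N ->
     pdmx A -> pdmx B ->
     loewner_le (mxfun f (geomean A B)) (mxfun f (mxmean (fmu p) A B))) :
  operator_monotone `]0, +oo[ f.
Proof.
split.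
  apply: continuous_subspaceW hfc => x /=.
  by rewrite !in_itv /= !andbT => /ltW.
move=> n A B n0 Ah Bh As Bs AB.
have A0 i : 0 < spectral_val A i by exact: spectrum_in_spectral_val.
have [C [D [Cp Dp <- <-]]] := mean_decomposition _ _ p _ _ hp0 Ah A0 Bh AB.
exact: hf.
Qed.
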